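(* Let $S^3$ carry the round metric of radius one and let $K\subset S^3$ be a knot type that is orbit realised by a smooth representative $J_0$; take $J_0$ as basepoint. Then for every $i\ge1$ and every $\alpha\in\pi_i(\mathscr{K}_K(S^3),J_0)$, $$\mathfrak{w}_i(\alpha;J_0)=\operatorname{Rop}_{S^3}(J_0),\qquad \ell_i(\alpha;J_0)=0,\qquad \sigma_i(K;J_0)=\operatorname{Rop}_{S^3}(J_0).$$ Consequently the persistent homotopy of the spherical ropelength filtration of $\mathscr{K}_K(S^3)$ surjects onto its stable value at the single finite level $\Lambda_0=\operatorname{Rop}_{S^3}(J_0)$, in every degree simultaneously: the map $\pi_i(\mathscr{K}_{K,\Lambda_0}(S^3),J_0)\to\pi_i(\mathscr{K}_K(S^3),J_0)$ induced by inclusion is surjective for every $i$.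
   Context: $\mathscr{K}_K(S^3)=\operatorname{Emb}^\infty_K(S^1,S^3)/\operatorname{Diff}(S^1)$ is the space of unoriented, unparameterised smooth knots of type $K$ (quotient of the space of smooth embeddings of type $K$ with the $C^\infty$ topology). For a smooth knot $J\subset S^3$, $\operatorname{Rop}_{S^3}(J)=\operatorname{Len}(J)/\operatorname{Thi}(J)$, where $\operatorname{Len}$ is length and $\operatorname{Thi}$ is the normal injectivity radius (supremum of the radii for which the normal exponential map of $J$ is an embedding), both in the round metric. $\mathscr{K}_{K,\Lambda}(S^3)=\{J\in\mathscr{K}_K(S^3):\operatorname{Rop}_{S^3}(J)\le\Lambda\}$. $K$ is orbit realised by $J_0$ if $J_0$ is a smooth representative of $K$ such that the inclusion of the orbit $SO(4)\cdot J_0$ into $\mathscr{K}_K(S^3)$ is surjective on $\pi_i$ for every $i\ge0$. For $i\ge1$ and $\alpha\in\pi_i(\mathscr{K}_K(S^3),J_0)$ the width is $$\mathfrak{w}_i(\alpha;J_0)=\inf\Bigl\{\sup_{z\in S^i}\operatorname{Rop}_{S^3}(F(z)):\ F:(S^i,* )\to(\mathscr{K}_K(S^3),J_0)\text{ continuous},\ [F]=\alpha\Bigr\},$$ the excess width is $\ell_i(\alpha;J_0)=\mathfrak{w}_i(\alpha;J_0)-\operatorname{Rop}_{S^3}(J_0)$, and $\sigma_i(K;J_0)=\sup_\alpha\mathfrak{w}_i(\alpha;J_0)$. *)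

(* Defs.v *)
From HB Require Import structures.
From mathcomp Require Import all_boot all_order all_algebra generic_quotient.
From mathcomp Require Import all_classical all_reals all_analysis.
From mathcomp Require Import lra.

Set Implicit Arguments.
Unset Strict Implicit.
Unset Printing Implicit Defensive.

Import Order.TTheory GRing.Theory Num.Theory.
Import numFieldNormedType.Exports.

Local Open Scope classical_set_scope.
Local Open Scope ring_scope.
Local Open Scope quotient_scope.

(** The library norm on ['rV_n] is the sup norm.  It induces the usual
    topology and the usual derivatives, but lengths have to be measured with
    the Euclidean norm [enorm]. *)

Definition dot (R : realType) (n : nat) (u v : 'rV[R]_n) : R :=
  \sum_(i < n) u 0 i * v 0 i.

Definition enorm (R : realType) (n : nat) (u : 'rV[R]_n) : R :=
  Num.sqrt (dot u u).

Definition unit_sphere (R : realType) (n : nat) : set 'rV[R]_n.+1 :=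
  [set x | dot x x = 1].

Definition sphere (R : realType) (n : nat) : Type :=
  set_type (@unit_sphere R n).
HB.instance Definition _ (R : realType) (n : nat) :=
  Topological.on (sphere R n).

Lemma unit_sphere_base (R : realType) (n : nat) :
  @unit_sphere R n (delta_mx 0 0).
Proof.
rewrite /unit_sphere/= /dot (bigD1 ord0)//= big1 => [|i i0].
  by rewrite !mxE !eqxx mulr1 addr0.
by rewrite !mxE (negbTE i0) mulr0.
Qed.

Definition sphere_base (R : realType) (n : nat) : sphere R n :=
  exist _ (delta_mx 0 0) (mem_set (@unit_sphere_base R n)).

Definition SO (R : realType) (n : nat) : set 'M[R]_n :=
  [set A | A *m A^T = 1%:M /\ \det A = 1].

(** [homotopy_group R i x0] is the set of based homotopy classes of based maps
    from (S^i, base point) to (X, x0); for [i = 0] it is the set of path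
    components of X.  Only its underlying set is needed, so the group law is not defined. *)

Record based_map (R : realType) (i : nat) (X : topologicalType) (x0 : X) :=
  BasedMap {
    based_fun :> sphere R i -> X;
    based_fun_continuous : continuous based_fun;
    based_fun_base : based_fun (sphere_base R i) = x0 }.

HB.instance Definition _ (R : realType) (i : nat) (X : topologicalType)
  (x0 : X) := gen_eqMixin (based_map R i x0).
HB.instance Definition _ (R : realType) (i : nat) (X : topologicalType)
  (x0 : X) := gen_choiceMixin (based_map R i x0).

Definition based_homotopic (R : realType) (i : nat) (X : topologicalType)
    (x0 : X) (f g : based_map R i x0) : Prop :=
  exists H : R * sphere R i -> X,
    [/\ {within `[0 : R, 1] `*` setT, continuous H},
        forall z, H (0, z) = f z,
        forall z, H (1, z) = g z &
        forall t : R, t \in `[0, 1] -> H (t, sphere_base R i) = x0].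

Section based_homotopic_equiv.
Context (R : realType) (i : nat) (X : topologicalType) (x0 : X).
Implicit Types f g h : based_map R i x0.

Lemma based_homotopic_refl f : based_homotopic f f.
Proof.
exists (f \o snd); split => //=; last by move=> t _; exact: based_fun_base.
apply: continuous_subspaceT => x.
by apply: continuous_comp; [exact: cvg_snd|exact: based_fun_continuous].
Qed.

Let slide (a b : R) (x : R * sphere R i) := (a * x.1 + b, x.2).

Let slide_continuous a b : continuous (slide a b).
Proof.
move=> x.
have c1 : (fun y : R * sphere R i => a * y.1 + b) y @[y --> x] --> a * x.1 + b.
  by apply: cvgD; [apply: cvgMl_tmp; exact: cvg_fst|exact: cvg_cst].
have c2 : (fun y : R * sphere R i => y.2) y @[y --> x] --> x.2 by exact: cvg_snd.
exact: (cvg_pair c1 c2).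
Qed.

Let within_slide (A B : set R) a b (H : R * sphere R i -> X) :
  (forall t, B t -> A (a * t + b)) ->
  {within A `*` setT, continuous H} ->
  {within B `*` setT, continuous (H \o slide a b)}.
Proof.
move=> AB /subspace_continuousP cH; apply/subspace_continuousP => x [Bx _].
have Asx : (A `*` [set: sphere R i]) (slide a b x) by split=> //; exact: AB.
move=> U /(cH _ Asx) cU; have := slide_continuous cU.
rewrite /fmap /within /= !nbhs_simpl /=.
by apply: filterS => y sU [By _]; apply: sU; split=> //; exact: AB.
Qed.

Lemma based_homotopic_sym f g : based_homotopic f g -> based_homotopic g f.
Proof.
move=> [H [cH H0 H1 Hb]]; exists (H \o slide (-1) 1); split.
- apply: within_slide cH => t /=; rewrite !in_itv/= mulN1r => /andP[t0 t1].
  by rewrite addrC subr_ge0 t1 gerBl t0.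
- by move=> z; rewrite /slide/= mulr0 add0r.
- by move=> z; rewrite /slide/= mulr1 addNr.
- move=> t; rewrite in_itv/= => /andP[t0 t1]; apply: Hb.
  by rewrite in_itv/= mulN1r addrC subr_ge0 t1 gerBl t0.
Qed.

Lemma based_homotopic_trans g f h :
  based_homotopic f g -> based_homotopic g h -> based_homotopic f h.
Proof.
move=> [H [cH H0 H1 Hb]] [K [cK K0 K1 Kb]].
pose L (x : R * sphere R i) :=
  if x.1 <= 2^-1 then H (slide 2 0 x) else K (slide 2 (-1) x).
have h0 : 0 <= 2^-1 :> R by rewrite invr_ge0.
have h2 : 2 * 2^-1 = 1 :> R by rewrite divff.
exists L; split.
- have -> : `[0 : R, 1]%classic `*` [set: sphere R i] =
    (`[0, 2^-1]%classic `*` setT) `|` (`[2^-1, 1]%classic `*` setT).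
    apply/seteqP; split => -[t z] /=; rewrite !in_itv/=.
      move=> [/andP[t0 t1] _]; have [th|/ltW th] := leP t 2^-1.
        by left; rewrite t0.
      by right; rewrite th t1.
    by move=> [] [/andP[ta tb] _]; split=> //; apply/andP; split; lra.
  have cl (a b : R) : closed (`[a, b]%classic `*` [set: sphere R i]).
    have -> : `[a, b]%classic `*` [set: sphere R i] = fst @^-1` `[a, b]%classic.
      by apply/seteqP; split => -[t z] /=; [case|].
    apply: preimage_closed; last exact: interval_closed.
    by move=> x _; exact: cvg_fst.
  apply: withinU_continuous => //.
    apply: (@subspace_eq_continuous _ _ _ (H \o slide 2 0) L).
      move=> [t z]; rewrite inE /= => -[/=]; rewrite in_itv/= => /andP[_ th] _.
      by rewrite /L/= th.
    apply: within_slide cH => t /=; rewrite !in_itv/= => /andP[t0 th].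
    by apply/andP; split; lra.
  apply: (@subspace_eq_continuous _ _ _ (K \o slide 2 (-1)) L).
    move=> [t z]; rewrite inE /= => -[/=]; rewrite in_itv/= => /andP[th _] _.
    rewrite /L/=; case: ifPn => // th'.
    have -> : t = 2^-1 by apply/le_anti; rewrite th th'.
    by rewrite /slide/= h2 addr0 subrr H1 K0.
  apply: within_slide cK => t /=; rewrite !in_itv/= => /andP[th t1].
  by apply/andP; split; lra.
- by move=> z; rewrite /L/= h0 /slide/= mulr0 addr0.
- move=> z; rewrite /L/= ifF; last by apply/negbTE; rewrite -ltNge; lra.
  by rewrite /slide/= (_ : 2 * 1 - 1 = 1) ?K1//; lra.
- move=> t; rewrite in_itv/= => /andP[t0 t1]; rewrite /L/=.
  case: ifPn => [th|]; [|rewrite -ltNge => th].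
    by apply: Hb; rewrite in_itv/=; apply/andP; split; lra.
  by apply: Kb; rewrite in_itv/=; apply/andP; split; lra.
Qed.

Let homotopic_rel (f g : based_map R i x0) : bool := `[< based_homotopic f g >].

Let homotopic_rel_refl : reflexive homotopic_rel.
Proof. by move=> f; apply/asboolP; exact: based_homotopic_refl. Qed.

Let homotopic_rel_sym : symmetric homotopic_rel.
Proof.
by move=> f g; apply/asboolP/asboolP; exact: based_homotopic_sym.
Qed.

Let homotopic_rel_trans : transitive homotopic_rel.
Proof.
move=> g f h /asboolP fg /asboolP gh.
by apply/asboolP; exact: based_homotopic_trans gh.
Qed.

Definition homotopy_rel : equiv_rel (based_map R i x0) :=
  EquivRel homotopic_rel homotopic_rel_refl homotopic_rel_sym
    homotopic_rel_trans.

Definition homotopy_group : Type := {eq_quot homotopy_rel}.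
HB.instance Definition _ := Choice.on homotopy_group.
HB.instance Definition _ := Quotient.on homotopy_group.
HB.instance Definition _ := EqQuotient.on homotopy_group.

Definition hclass (f : based_map R i x0) : homotopy_group :=
  \pi_homotopy_group f.

Lemma hclass_eq f g : hclass f = hclass g <-> based_homotopic f g.
Proof.
split=> [/eqmodP/asboolP //|fg].
by apply/eqmodP/asboolP.
Qed.

End based_homotopic_equiv.

Section homotopy_functor.
Context (R : realType) (i : nat).

Section induced.
Context (X Y : topologicalType) (f : X -> Y) (cf : continuous f) (x0 : X).

Let push_continuous (g : based_map R i x0) : continuous (f \o g).
Proof.
by move=> z; apply: continuous_comp; [exact: based_fun_continuous|exact: cf].
Qed.

Let push_base (g : based_map R i x0) : (f \o g) (sphere_base R i) = f x0.
Proof. by rewrite /= based_fun_base. Qed.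

Definition push (g : based_map R i x0) : based_map R i (f x0) :=
  BasedMap (@push_continuous g) (@push_base g).

Definition pi_map (a : homotopy_group R i x0) : homotopy_group R i (f x0) :=
  hclass (push (repr a)).

Lemma pi_mapE (g : based_map R i x0) : pi_map (hclass g) = hclass (push g).
Proof.
apply/hclass_eq; have /hclass_eq [H [cH H0 H1 Hb]] :
  hclass (repr (hclass g)) = hclass g by rewrite /hclass reprK.
exists (f \o H); split => /=.
- move=> x; apply: (@continuous_comp (subspace _) X Y); first exact: cH.
  exact: cf.
- by move=> z; rewrite H0.
- by move=> z; rewrite H1.
- by move=> t /Hb ->.
Qed.

End induced.

Section inclusion.
Context (X : topologicalType) (A : set X) (x0 : X) (Ax0 : A x0).

Definition sub_point : set_type A := exist _ x0 (mem_set Ax0).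

Definition pi_incl : homotopy_group R i sub_point -> homotopy_group R i x0 :=
  pi_map (@initial_continuous (set_type A) X set_val) (x0 := sub_point).

End inclusion.
End homotopy_functor.

Section smooth.
Context (R : realType).

Definition smooth_curve (V : normedModType R) (c : R -> V) : Prop :=
  forall n t, derivable (derive1n n c) t 1.

(** On finite-dimensional spaces this is the usual class C^n, written in terms
    of iterated directional derivatives. *)
Fixpoint Cn (U V : normedModType R) (n : nat) (f : U -> V) : Prop :=
  if n is m.+1 then
    (forall x, differentiable f x) /\ (forall v, Cn m (fun x => 'D_v f x))
  else continuous f.

Definition smooth_map (U V : normedModType R) (f : U -> V) : Prop :=
  forall n, Cn n f.

Fixpoint diffn (n : nat) (f : R -> R) : Prop :=
  (forall t, derivable f t 1) /\
  (if n is m.+1 then diffn m (derive1 f) else True).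

Lemma smooth_curveE (f : R -> R) : smooth_curve f <-> forall n, diffn n f.
Proof.
split=> [sf n|df n t].
  elim: n f sf => [|n IH] f sf /=; split=> //; try exact: (sf 0%N).
  by apply: IH => m t; rewrite -derive1Sn; exact: sf.
move: (df n) => {df}.
elim: n f => [|n IH] f [df dn]; first exact: df.
by rewrite derive1Sn; exact: IH.
Qed.

Lemma diffn_derivable n f : diffn n f -> forall t, derivable f t 1.
Proof. by case: n => [|n] []. Qed.

Lemma diffnW n f : diffn n.+1 f -> diffn n f.
Proof.
elim: n f => [|n IH] f; first by case.
by case=> df d1; split=> //; exact: IH.
Qed.

Lemma diffnD n f g : diffn n f -> diffn n g -> diffn n (f \+ g).
Proof.
elim: n f g => [|n IH] f g [df f1] [dg g1]; split=> //=.
- by move=> t; exact: derivableD.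
- by move=> t; exact: derivableD.
- have -> : derive1 (f \+ g) = derive1 f \+ derive1 g.
    by apply/funext => t /=; rewrite !derive1E deriveD.
  exact: IH.
Qed.

Lemma diffnM n f g : diffn n f -> diffn n g -> diffn n (f \* g).
Proof.
elim: n f g => [|n IH] f g ff gg.
  have df := diffn_derivable ff; have dg := diffn_derivable gg.
  by split=> // t; exact: derivableM.
have df := diffn_derivable ff; have dg := diffn_derivable gg.
split=> [t|]; first exact: derivableM.
have -> : derive1 (f \* g) = (f \* derive1 g) \+ (g \* derive1 f).
  by apply/funext => t /=; rewrite !derive1E deriveM.
by apply: diffnD; apply: IH; try exact: diffnW; [case: gg|case: ff].
Qed.

Lemma diffn_comp n f g : diffn n f -> diffn n g -> diffn n (g \o f).
Proof.
elim: n f g => [|n IH] f g ff gg;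
  have df := diffn_derivable ff; have dg := diffn_derivable gg.
  by split=> // t; apply/derivable1_diffP/differentiable_comp;
    exact/derivable1_diffP.
split=> [t|].
  by apply/derivable1_diffP/differentiable_comp; exact/derivable1_diffP.
have -> : derive1 (g \o f) = (derive1 g \o f) \* derive1 f.
  by apply/funext => t /=; rewrite derive1_comp.
apply: diffnM; last by case: ff.
by apply: IH; [exact: diffnW|case: gg].
Qed.

Lemma smooth_curve_comp (f g : R -> R) :
  smooth_curve f -> smooth_curve g -> smooth_curve (g \o f).
Proof.
move=> /smooth_curveE sf /smooth_curveE sg; apply/smooth_curveE => n.
exact: diffn_comp.
Qed.

Lemma smooth_curve_id : smooth_curve (@idfun R).
Proof.
apply/smooth_curveE.
have cstn c n : diffn n (cst c).
  elim: n c => [|n IH] c; split=> //; try by move=> t; exact: derivable_cst.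
  have -> : derive1 (cst c) = cst 0 :> (R -> R).
    by apply/funext => t; rewrite derive1_cst.
  exact: IH.
case=> [|n]; split=> //; try by move=> t; exact: derivable_id.
have -> : derive1 (@idfun R) = cst 1.
  by apply/funext => t; rewrite derive1E derive_id.
exact: cstn.
Qed.

End smooth.

(** The circle is R / Z: a map out of it is a 1-periodic map on R. *)

Section knots.
Context (R : realType).
Local Notation E4 := 'rV[R]_4.
Local Notation S3 := (@unit_sphere R 3).

Record knot_embedding := KnotEmbedding {
  knot_curve :> R -> E4;
  knot_smooth : smooth_curve knot_curve;
  knot_periodic : forall t, knot_curve (t + 1) = knot_curve t;
  knot_in_sphere : forall t, S3 (knot_curve t);
  knot_immersion : forall t, derive1 knot_curve t <> 0;
  knot_injective : forall s t, knot_curve s = knot_curve t ->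
    s - t \is a Num.int;
  (* the inverse from the image to R / Z is continuous *)
  knot_inverse_continuous : forall t (U : set R), nbhs t U ->
    exists2 W : set E4, nbhs (knot_curve t) W &
      forall s, W (knot_curve s) -> exists2 u, U u & s - u \is a Num.int }.

HB.instance Definition _ := gen_eqMixin knot_embedding.
HB.instance Definition _ := gen_choiceMixin knot_embedding.

(** C^oo topology: uniform convergence of every derivative. *)
Definition knot_jet (g : knot_embedding) :
    prod_topology (fun _ : nat => {uniform R -> E4}) :=
  fun n => derive1n n g.

HB.instance Definition _ :=
  Topological.copy knot_embedding (initial_topology knot_jet).

(** A smooth isotopy of S^3, and the family of its inverses, extend from
    [0, 1] x S^3 to smooth maps on R x R^4. *)
Definition ambient_isotopic (J J' : set E4) : Prop :=
  exists H G : R * E4 -> E4,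
    [/\ smooth_map H, smooth_map G,
        forall (t : R) x, t \in `[0, 1] -> S3 x ->
          [/\ S3 (H (t, x)), S3 (G (t, x)),
              G (t, H (t, x)) = x & H (t, G (t, x)) = x],
        forall x, S3 x -> H (0, x) = x &
        [set H (1, x) | x in J] = J'].

Definition of_knot_type (K : knot_embedding) : set knot_embedding :=
  [set g | ambient_isotopic (range K) (range g)].

Definition emb_of_type (K : knot_embedding) : Type :=
  set_type (of_knot_type K).
HB.instance Definition _ (K : knot_embedding) :=
  Topological.on (emb_of_type K).

Definition curve_of (K : knot_embedding) (g : emb_of_type K) : R -> E4 :=
  set_val g.

(** Diffeomorphisms of R / Z are given by their lifts to R. *)

Definition descends (f : R -> R) : Prop :=
  forall s t, s - t \is a Num.int -> f s - f t \is a Num.int.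

Definition circle_diffeo (f : R -> R) : Prop :=
  exists g : R -> R,
    [/\ smooth_curve f, smooth_curve g, descends f, descends g &
        cancel f g /\ cancel g f].

Definition reparam (c c' : R -> E4) : Prop :=
  exists2 f, circle_diffeo f & c' = c \o f.

Lemma circle_diffeo_id : circle_diffeo idfun.
Proof. by exists idfun; split=> //; exact: smooth_curve_id. Qed.

Lemma circle_diffeo_comp f f' :
  circle_diffeo f -> circle_diffeo f' -> circle_diffeo (f' \o f).
Proof.
move=> [g [sf sg df dg [fg gf]]] [g' [sf' sg' df' dg' [fg' gf']]].
exists (g \o g'); split.
- exact: smooth_curve_comp.
- exact: smooth_curve_comp.
- by move=> s t /df /df'.
- by move=> s t /dg' /dg.
- by split; exact: can_comp.
Qed.

Section quotient.
Variable K : knot_embedding.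

Let reparam_rel (g g' : emb_of_type K) : bool :=
  `[< reparam (curve_of g) (curve_of g') >].

Let reparam_rel_refl : reflexive reparam_rel.
Proof.
by move=> g; apply/asboolP; exists idfun => //; exact: circle_diffeo_id.
Qed.

Let reparam_rel_sym : symmetric reparam_rel.
Proof.
suff h g g' : reparam_rel g g' -> reparam_rel g' g.
  by move=> g g'; apply/idP/idP; exact: h.
move=> /asboolP [f [f' [sf sf' df df' [ff' f'f]]] e].
apply/asboolP; exists f'; first by exists f.
by rewrite e; apply/funext => t /=; rewrite f'f.
Qed.

Let reparam_rel_trans : transitive reparam_rel.
Proof.
move=> g1 g2 g3 /asboolP [f df e] /asboolP [f' df' e'].
apply/asboolP; exists (f \o f'); first exact: circle_diffeo_comp.
by rewrite e' e.
Qed.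

Definition reparam_equiv : equiv_rel (emb_of_type K) :=
  EquivRel reparam_rel reparam_rel_refl reparam_rel_sym reparam_rel_trans.

Definition knot_space : Type := quotient_topology {eq_quot reparam_equiv}.
HB.instance Definition _ := Topological.on knot_space.
HB.instance Definition _ := Quotient.on knot_space.

Definition unparam (g : emb_of_type K) : knot_space := \pi_knot_space g.

Lemma unparam_eq g g' :
  unparam g = unparam g' <-> reparam (curve_of g) (curve_of g').
Proof.
by split=> [/eqmodP/asboolP //|h]; apply/eqmodP/asboolP.
Qed.

End quotient.

(** The normal bundle of the knot in S^3, as a subset of R^4 x R^4, cut down
    to vectors of length less than [r]. *)
Definition normal_tube (c : R -> E4) (r : R) : set (E4 * E4) :=
  [set x | (exists t, [/\ x.1 = c t, dot x.2 (c t) = 0 &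
                          dot x.2 (derive1 c t) = 0]) /\ enorm x.2 < r].

(** exp_p(v) = cos |v| p + sin |v| v / |v|; the value at v = 0 is p because
    the second summand is then 0. *)
Definition sphere_exp (x : E4 * E4) : E4 :=
  cos (enorm x.2) *: x.1 + (sin (enorm x.2) / enorm x.2) *: x.2.

(** Injective immersion which is a homeomorphism onto its image.  Tangent
    vectors of [M] are the velocities of smooth curves in [M]. *)
Definition embeds (U V : normedModType R) (M : set U) (f : U -> V) : Prop :=
  [/\ {within M, continuous f},
      {in M &, injective f},
      (forall c : R -> U, smooth_curve c -> (forall t, M (c t)) ->
        derive1 (f \o c) 0 = 0 -> derive1 c 0 = 0) &
      (forall x, M x -> forall W : set U, nbhs x W ->
        exists2 W' : set V, nbhs (f x) W' & M `&` f @^-1` W' `<=` W)].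

Definition Len (c : R -> E4) : R :=
  \int[lebesgue_measure]_(t in `[0, 1]) enorm (derive1 c t).

(** For a smooth knot the set of admissible radii is nonempty (tubular
    neighbourhoods) and bounded by the number pi, so [sup] is the genuine
    supremum. *)
Definition Thi (c : R -> E4) : R :=
  sup [set r | 0 < r /\ embeds (normal_tube c r) sphere_exp].

(** [Len] and [Thi] do not depend on the parameterisation [repr J]. *)
Definition Rop (K : knot_embedding) (J : knot_space K) : R :=
  Len (curve_of (repr J)) / Thi (curve_of (repr J)).

Definition sublevel (K : knot_embedding) (L : R) : set (knot_space K) :=
  [set J | Rop J <= L].

Lemma sublevel_self (K : knot_embedding) (J0 : knot_space K) :
  sublevel (Rop J0) J0.
Proof. exact: lexx. Qed.

(** SO(4) acts on row vectors from the right.  Requiring [g] to be of type K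
    excludes nothing: SO(4) is path connected, so it preserves knot types. *)
Definition SO4_orbit (K : knot_embedding) (J0 : knot_space K) :
    set (knot_space K) :=
  [set J | exists A g0 g, [/\ @SO R 4 A, unparam g0 = J0, unparam g = J &
                             forall t, curve_of g t = curve_of g0 t *m A]].

Lemma SO4_orbit_self (K : knot_embedding) (J0 : knot_space K) :
  SO4_orbit J0 J0.
Proof.
exists 1%:M, (repr J0), (repr J0); split; rewrite ?/unparam ?reprK//.
  by split; rewrite ?trmx1 ?mulmx1 ?det1.
by move=> t; rewrite mulmx1.
Qed.

Definition orbit_realised (K : knot_embedding) (J0 : knot_space K) : Prop :=
  forall (i : nat) (a : homotopy_group R i J0),
    exists b : homotopy_group R i (sub_point (SO4_orbit_self J0)),
      pi_incl b = a.

Local Open Scope ereal_scope.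

Definition width (K : knot_embedding) (J0 : knot_space K) (i : nat)
    (a : homotopy_group R i J0) : \bar R :=
  ereal_inf [set ereal_sup [set (Rop (F z))%:E | z in setT]
            | F in [set F : based_map R i J0 | hclass F = a]].

Definition excess_width (K : knot_embedding) (J0 : knot_space K) (i : nat)
    (a : homotopy_group R i J0) : \bar R :=
  width a - (Rop J0)%:E.

Definition sigma_width (K : knot_embedding) (J0 : knot_space K) (i : nat) :
    \bar R :=
  ereal_sup [set width a | a in [set: homotopy_group R i J0]].

End knots.

(* Main.v *)
(** Ropelength is invariant under reparameterisation and under SO(4), hence
    constant on the orbit of [J0].  By hypothesis every homotopy class has a
    representative with values in this orbit, on which the supremum of the
    ropelength is [Rop J0]; and no representative can do better, because it
    passes through [J0].  The same representatives lie in the sublevel set at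
    [Rop J0]. *)

Require Import Defs.
From HB Require Import structures.
From mathcomp Require Import all_boot all_order all_algebra.
From mathcomp Require Import all_classical all_reals all_analysis.
From mathcomp Require Import ring lra zify.

Set Implicit Arguments.
Unset Strict Implicit.
Unset Printing Implicit Defensive.

Import Order.TTheory GRing.Theory Num.Theory.
Import numFieldNormedType.Exports.

Local Open Scope classical_set_scope.
Local Open Scope ring_scope.

(** * Chain rules for curves, the fundamental theorem of calculus, and integrals over a period *)

Section calculus.
Context (R : realType).

Lemma derive1_comp_curve (V : normedModType R) (f : R -> R) (c : R -> V) t :
  derivable f t 1 -> derivable c (f t) 1 ->
  derive1 (c \o f) t = derive1 f t *: derive1 c (f t).
Proof.
move=> /derivable1_diffP df /derivable1_diffP dc.
rewrite derive1E'; last exact: differentiable_comp.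
by rewrite (diff_comp df dc) /= (diff1E df) (diff1E dc) scale1r.
Qed.

Section continuous_linear.
Context (V W : normedModType R) (L : {linear V -> W}).
Hypothesis Lcont : continuous L.

Lemma derivable_linear_comp (c : R -> V) t :
  derivable c t 1 -> derivable (L \o c) t 1.
Proof.
move=> /derivable1_diffP dc; apply/derivable1_diffP/differentiable_comp => //.
exact: linear_differentiable.
Qed.

Lemma derive1_linear_comp (c : R -> V) t :
  derivable c t 1 -> derive1 (L \o c) t = L (derive1 c t).
Proof.
move=> /derivable1_diffP dc.
have dL : differentiable L (c t) by exact: linear_differentiable.
rewrite derive1E'; last exact: differentiable_comp.
by rewrite (diff_comp dc dL) /= (diff1E dc) (diff_lin _ Lcont) scale1r.
Qed.

Lemma smooth_curve_linear_comp (c : R -> V) :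
  smooth_curve c -> smooth_curve (L \o c).
Proof.
move=> sc; have dE n : derive1n n (L \o c) = L \o derive1n n c.
  elim: n => // n IH; rewrite !derive1nS IH; apply/funext => t.
  by rewrite derive1_linear_comp.
by move=> n t; rewrite dE; exact: derivable_linear_comp.
Qed.

End continuous_linear.

Lemma derivable_continuous (V : normedModType R) (c : R -> V) :
  (forall t, derivable c t 1) -> continuous c.
Proof. by move=> dc t; apply/differentiable_continuous/derivable1_diffP. Qed.

Lemma smooth_curve_continuous (V : normedModType R) (c : R -> V) n :
  smooth_curve c -> continuous (derive1n n c).
Proof. by move=> sc; apply: derivable_continuous => t; exact: sc. Qed.

Lemma Rintegral_FTC2 (f F : R -> R) (a b : R) : a <= b -> continuous f ->
  {in `[a, b], forall x, derivable F x 1 /\ derive1 F x = f x} ->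
  \int[lebesgue_measure]_(x in `[a, b]) f x = F b - F a.
Proof.
move=> ab cf dF; move: ab; rewrite le_eqVlt => /orP[/eqP ab|ab].
  by rewrite -ab set_itv1 Rintegral_set1 subrr.
have cF x : x \in `[a, b] -> {for x, continuous F}.
  by move=> /dF[/derivable1_diffP /differentiable_continuous].
rewrite /Rintegral (@continuous_FTC2 _ f F)//.
- exact: continuous_subspaceT.
- split.
  + by move=> x xab; have [] := dF x (subset_itv_oo_cc xab).
  + by apply: cvg_at_right_filter; apply: cF; rewrite in_itv/= lexx ltW.
  + by apply: cvg_at_left_filter; apply: cF; rewrite in_itv/= lexx ltW.
- by move=> x xab; have [_] := dF x (subset_itv_oo_cc xab).
Qed.

(** The primitive is the integral from [a], so it is controlled only to the right of [a]; each use
    picks [a] one unit below all the points that occur. *)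
Lemma continuous_primitive (f : R -> R) (a : R) : continuous f ->
  exists F : R -> R, forall x, a < x -> derivable F x 1 /\ derive1 F x = f x.
Proof.
move=> cf; exists (fun x => \int[lebesgue_measure]_(t in `[a, x]) f t) => x ax.
apply: (@continuous_FTC1_closed _ f a x (x + 1)) => //.
- by rewrite ltrDl.
- apply: continuous_compact_integrable; first exact: segment_compact.
  exact: continuous_subspaceT.
- exact: cf.
Qed.

(** For a primitive [F], the function [D u = F (u + 1) - F u] has derivative [f (u + 1) - f u = 0].
    The fundamental theorem applied to [D] with integrand zero then gives [D z - D y = 0]. *)
Lemma Rintegral_period (f : R -> R) (x : R) : continuous f ->
  (forall t, f (t + 1) = f t) ->
  \int[lebesgue_measure]_(t in `[x, x + 1]) f t =
  \int[lebesgue_measure]_(t in `[0, 1]) f t.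
Proof.
move=> cf pf.
(* The primitive needs a lower end, so two starting points are compared in increasing order; [x] and
   [0] may come in either order. *)
wlog suff H : / forall y z, y <= z ->
  \int[lebesgue_measure]_(t in `[y, y + 1]) f t =
  \int[lebesgue_measure]_(t in `[z, z + 1]) f t.
  rewrite -[in RHS](add0r 1).
  by have [/H//|/ltW/H] := leP x 0.
move=> y z yz; have [F dF] := continuous_primitive (y - 1) cf.
have FTC u : y <= u ->
    \int[lebesgue_measure]_(t in `[u, u + 1]) f t = F (u + 1) - F u.
  move=> yu; apply: Rintegral_FTC2 => //; first by rewrite lerDl.
  by move=> t; rewrite in_itv/= => /andP[ut _]; apply: dF; lra.
rewrite !FTC//; apply/eqP; rewrite -subr_eq0 -opprB oppr_eq0; apply/eqP.
pose D := (F \o shift 1) - F.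
rewrite -[LHS]/(D z - D y) -(@Rintegral_FTC2 (cst 0) D)//.
- by rewrite Rintegral_cst ?mul0r.
- exact: cst_continuous.
move=> t; rewrite in_itv/= => /andP[yt _].
have [d1 e1] : derivable F t 1 /\ derive1 F t = f t by apply: dF; lra.
have [d2 e2] : derivable F (t + 1) 1 /\ derive1 F (t + 1) = f (t + 1).
  by apply: dF; lra.
have ds : is_derive t 1 (shift (1 : R)) 1.
  by rewrite -[X in is_derive _ _ _ X]addr0; exact: is_deriveD.
have ds' : derivable (shift (1 : R)) t 1 by case: ds.
have dFs : derivable (F \o shift 1) t 1.
  move: (ds') (d2) => /derivable1_diffP ds'' /derivable1_diffP d2'.
  by apply/derivable1_diffP; exact: (differentiable_comp ds'' d2').
split; first exact: (derivableB dFs d1).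
rewrite derive1E (deriveB dFs d1) -!derive1E e1 (derive1_comp ds' d2).
by rewrite [X in X * _]e2 pf derive1E (@derive_val _ _ _ _ _ _ _ ds) mulr1
  subrr.
Qed.

End calculus.

(** * Lifts of circle diffeomorphisms: sign of the derivative, degree, change of variables *)

Section circle_diffeomorphism.
Context (R : realType) (f : R -> R).
Hypothesis df : circle_diffeo f.

Lemma circle_diffeo_derive_neq0 t : derive1 f t != 0.
Proof.
have [g [sf sg _ _ [fg _]]] := df; apply/eqP => f0.
have /eqP := derive1_comp (sf 0%N t) (sg 0%N (f t)).
rewrite f0 mulr0 (_ : g \o f = idfun); last by apply/funext => x; exact: fg.
by rewrite derive1E derive_id oner_eq0.
Qed.

(** A sign change of the continuous derivative would produce a zero by the intermediate value
    theorem. The sign is recorded as a factor [s], so that [|derive1 f t|] can be integrated as a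
    constant multiple of [derive1 f t]. *)
Lemma circle_diffeo_derive_sign :
  exists2 s : R, `|s| = 1 & forall t, `|derive1 f t| = s * derive1 f t.
Proof.
have f'0 := circle_diffeo_derive_neq0.
have cf' : continuous (derive1 f).
  by have [g [sf _ _ _ _]] := df; exact: (@smooth_curve_continuous _ _ f 1).
have same x y : x <= y -> 0 < derive1 f x * derive1 f y.
  move=> xy; rewrite ltNge; apply/negP => xy0.
  have [||c _ /eqP] := @IVT R (derive1 f) x y 0 xy.
  - exact: continuous_subspaceT.
  - move: xy0; rewrite ge_min le_max.
    have [x0|x0] := leP (derive1 f x) 0; have [y0|y0] := leP (derive1 f y) 0;
      rewrite ?orbT ?(ltW x0) ?(ltW y0) ?orbT//.
      by rewrite leNgt nmulr_lgt0 ?lt_neqAle ?f'0 ?x0 ?y0.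
    by rewrite leNgt mulr_gt0.
  - by rewrite (negbTE (f'0 c)).
have all0 t : 0 < derive1 f 0 * derive1 f t.
  by have [/same//|/ltW/same] := leP 0 t; rewrite mulrC.
exists (Num.sg (derive1 f 0)); first by rewrite normr_sg f'0.
move=> t; rewrite [LHS]normrEsg; congr (_ * _).
move: (all0 t) (f'0 0) (f'0 t); rewrite -sgr_gt0 sgrM.
by case: (sgrP (derive1 f 0)); case: (sgrP (derive1 f t)) => //; lra.
Qed.

(* If [f 1 - f 0] is a nonzero integer, [f] takes the value [f 0 + s] with
   [s = 1] or [s = -1] at some [c] of [0, 1]; then [c] is an integer because the
   inverse lift descends, so [c = 1]. *)
Lemma circle_diffeo_degree : `|f 1 - f 0| = 1.
Proof.
have [g [sf _ df' dg [fg gf]]] := df.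
have /intrP[m fm] : f 1 - f 0 \is a Num.int by apply: df'; rewrite subr0.
have m0 : m != 0.
  apply/eqP => m0; move: fm; rewrite m0 => /eqP; rewrite subr_eq0 => /eqP.
  by move=> /(can_inj fg) /eqP; rewrite oner_eq0.
have [s s1 [sint hs]] : exists2 s : R, `|s| = 1 &
    s \is a Num.int /\ Num.min (f 0) (f 1) <= f 0 + s <= Num.max (f 0) (f 1).
  have [mn|mp|/eqP] := ltrgtP m 0; last by rewrite (negbTE m0).
  - exists (-1); [by rewrite normrN1|split; first by rewrite rpredN rpred1].
    have : m%:~R <= (-1)%:~R :> R by rewrite ler_int; lia.
    by rewrite ge_min le_max => ?; apply/andP; split; apply/orP;
      [right|left]; lra.
  - exists 1; [by rewrite normr1|split; first by rewrite rpred1].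
    have : 1%:~R <= m%:~R :> R by rewrite ler_int; lia.
    by rewrite ge_min le_max => ?; apply/andP; split; apply/orP;
      [left|right]; lra.
have [|c c01 fc] := @IVT R f 0 1 (f 0 + s) ler01 _ hs.
  exact/continuous_subspaceT/(@smooth_curve_continuous _ _ f 0).
have /intrP[k ck] : c \is a Num.int.
  rewrite -[c]subr0 -(fg c) -(fg 0); apply: dg.
  by rewrite fc addrAC subrr add0r.
move: c01 fc; rewrite ck in_itv/= (ler_int _ 0) (ler_int _ _ 1) => k01.
have [->|->] : k = 0 \/ k = 1 by lia.
  move=> /eqP; rewrite addrC -subr_eq subrr => /eqP s0; move: s1.
  by rewrite -s0 normr0 => /esym/eqP; rewrite oner_eq0.
by move=> ->; rewrite addrAC subrr add0r.
Qed.

(** If [P] is a primitive of [L], then [s *: (P \o f)] is a primitive of the left integrand. Since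
    [f 1 = f 0 + s], the left side is the integral of [L] over an interval of length one, that is,
    over a full period. *)
Lemma Rintegral_circle_diffeo (L : R -> R) : continuous L ->
  (forall t, L (t + 1) = L t) ->
  \int[lebesgue_measure]_(t in `[0, 1]) (L (f t) * `|derive1 f t|) =
  \int[lebesgue_measure]_(t in `[0, 1]) L t.
Proof.
move=> cL pL; have [s s1 sE] := circle_diffeo_derive_sign.
have [g [sf _ _ _ _]] := df.
have cf : continuous f by exact: (@smooth_curve_continuous _ _ f 0).
have cf' : continuous (derive1 f) by exact: (@smooth_curve_continuous _ _ f 1).
(* The mean value theorem writes [f 1 - f 0] as some [derive1 f c]. Its absolute value is 1 by the
   degree and equals [s * derive1 f c], so multiplying by [s] gives the claim, as [s ^+ 2 = 1]. *)
have f10 : f 1 - f 0 = s.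
  have dfx (x : R) : x \in `]0, 1[%R -> is_derive x 1 f (derive1 f x).
    by move=> _; rewrite derive1E; apply: DeriveDef => //; exact: (sf 0%N).
  have [] := @MVT R f (derive1 f) 0 1 ltr01 dfx.
    exact: continuous_subspaceT.
  move=> c _; rewrite subr0 mulr1 => fc.
  have := sE c; rewrite -fc circle_diffeo_degree => /(congr1 ( *%R s)).
  rewrite mulr1 mulrA -expr2 -(real_normK (num_real s)) s1 expr1n mul1r.
  by move=> ->.
(* The minimum [f c] of [f] on [0, 1] supplies a base point [f c - 1] strictly below every value at
   which the primitive is evaluated. *)
have [c c01 cmin] := @EVT_min R f 0 1 ler01 (continuous_subspaceT cf).
have [P dP] := continuous_primitive (f c - 1) cL.
pose Q : R -> R := s *: (P \o f).
have -> : \int[lebesgue_measure]_(t in `[0, 1]) (L (f t) * `|derive1 f t|) =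
    Q 1 - Q 0.
  apply: Rintegral_FTC2 => //.
    move=> t; apply: cvgM.
      by apply: continuous_comp; [exact: cf|exact: cL].
    by apply: cvg_norm; exact: cf'.
  move=> t t01; have [d1 e1] : derivable P (f t) 1 /\ derive1 P (f t) = L (f t).
    by apply: dP; have := cmin t t01; lra.
  have d2 : derivable (P \o f) t 1.
    move: (sf 0%N t) d1 => /derivable1_diffP d0 /derivable1_diffP d1.
    by apply/derivable1_diffP; exact: (differentiable_comp d0 d1).
  split; first by apply: derivableZ; exact: d2.
  rewrite derive1E (deriveZ _ d2) -derive1E (derive1_comp (sf 0%N t) d1) e1 sE.
  by rewrite /GRing.scale/=; ring.
have FTC x : f c <= x ->
    P (x + 1) - P x = \int[lebesgue_measure]_(t in `[0, 1]) L t.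
  move=> cx; rewrite -(Rintegral_period x cL pL).
  apply/esym/Rintegral_FTC2 => //.
    by rewrite lerDl.
  by move=> t; rewrite in_itv/= => /andP[xt _]; apply: dP; lra.
have f0c : f c <= f 0 by apply: cmin; rewrite in_itv/= lexx ler01.
have f1c : f c <= f 1 by apply: cmin; rewrite in_itv/= lexx ler01.
rewrite [LHS](_ : _ = s * (P (f 1) - P (f 0))); last by rewrite mulrBr.
(* According to orientation, the period runs from [f 0] to [f 0 + 1 = f 1], or from [f 1] to
   [f 1 + 1 = f 0]. *)
have /orP[/eqP sE1|/eqP sE1] : (s == 1) || (s == -1).
  by have := eqr_norml s 1; rewrite s1 eqxx ler01 andbT => <-.
- by rewrite sE1 mul1r -(FTC _ f0c); congr (P _ - _); lra.
- by rewrite sE1 mulN1r opprB -(FTC _ f1c); congr (P _ - _); lra.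
Qed.

End circle_diffeomorphism.

(** * The Euclidean inner product, orthogonal matrices, and continuity *)

Section euclidean.
Context (R : realType).

Lemma dotZl n (a : R) (u v : 'rV[R]_n) : dot (a *: u) v = a * dot u v.
Proof. by rewrite /dot mulr_sumr; apply: eq_bigr => i _; rewrite mxE mulrA. Qed.

Lemma dotZr n (a : R) (u v : 'rV[R]_n) : dot u (a *: v) = a * dot u v.
Proof.
by rewrite /dot mulr_sumr; apply: eq_bigr => i _; rewrite mxE mulrCA.
Qed.

Lemma enormZ n (a : R) (u : 'rV[R]_n) : enorm (a *: u) = `|a| * enorm u.
Proof.
by rewrite /enorm dotZl dotZr mulrA -expr2 sqrtrM ?sqr_ge0// sqrtr_sqr.
Qed.

Lemma dot_orthogonal n (A : 'M[R]_n) (u v : 'rV[R]_n) : A *m A^T = 1%:M ->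
  dot (u *m A) (v *m A) = dot u v.
Proof.
have dotE (x y : 'rV[R]_n) : dot x y = (x *m y^T) 0 0.
  by rewrite mxE; apply: eq_bigr => i _; rewrite mxE.
by move=> AA; rewrite !dotE trmx_mul mulmxA -(mulmxA u) AA mulmx1.
Qed.

Lemma enorm_orthogonal n (A : 'M[R]_n) (u : 'rV[R]_n) : A *m A^T = 1%:M ->
  enorm (u *m A) = enorm u.
Proof. by move=> AA; rewrite /enorm dot_orthogonal. Qed.

Lemma enorm_continuous n : continuous (@enorm R n).
Proof.
have cdot : continuous (fun u : 'rV[R]_n => dot u u).
  rewrite /dot; apply: continuous_big => [|i _ u]; first exact: add_continuous.
  have cu := @coord_continuous R 1 n 0 i u.
  exact: (cvgM cu cu).
by move=> u; apply: (continuous_comp (cdot u)); exact: sqrt_continuous.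
Qed.

Lemma mulmxr_continuous n p (A : 'M[R]_(n, p)) :
  continuous (mulmxr A : 'rV[R]_n -> 'rV[R]_p).
Proof.
have -> : (mulmxr A : 'rV_n -> 'rV_p) = fun u => \sum_i u 0 i *: row i A.
  by apply/funext => u; rewrite /= mulmx_sum_row.
apply: continuous_big => [|i _ u]; first exact: add_continuous.
have cu := @coord_continuous R 1 n 0 i u.
exact: (cvgZr_tmp cu).
Qed.

End euclidean.

(** * Invariance of length, thickness and ropelength under reparameterisation *)

Section reparametrisation.
Context (R : realType).

(** The difference quotients at [t + 1] and at [t] are the same function of the increment, hence
    have the same [lim]. *)
Lemma derive1_periodic (V : normedModType R) (c : R -> V) t :
  (forall t, c (t + 1) = c t) -> derive1 c (t + 1) = derive1 c t.
Proof.
move=> pc; rewrite /derive1; set F := (F in lim (F @ _)).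
set G := (G in _ = lim (G @ _)).
by rewrite (_ : F = G)//; apply/funext => h; rewrite /F /G addrA !pc.
Qed.

Section knot.
Context (c : knot_embedding R) (f : R -> R).
Hypothesis df : circle_diffeo f.

Lemma derive1_reparam t :
  derive1 (c \o f) t = derive1 f t *: derive1 c (f t).
Proof.
have [g [sf _ _ _ _]] := df.
by apply: derive1_comp_curve; [exact: (sf 0%N)|exact: (@knot_smooth R c 0%N)].
Qed.

Lemma Len_reparam : Len (c \o f) = Len c.
Proof.
pose L t := enorm (derive1 c t).
have cL : continuous L.
  move=> t; apply: continuous_comp; last exact: enorm_continuous.
  exact: (@smooth_curve_continuous _ _ _ 1 (@knot_smooth R c)).
have pL t : L (t + 1) = L t.
  by rewrite /L derive1_periodic//; exact: knot_periodic.
rewrite /Len -[RHS](Rintegral_circle_diffeo df cL pL).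
by apply: eq_Rintegral => t _; rewrite derive1_reparam enormZ mulrC.
Qed.

(** The tangent vector is only rescaled by the nonzero factor [derive1 f t], so the normal spaces
    agree; the inverse lift [g] shows that every point of [c] is reached. *)
Lemma normal_tube_reparam : normal_tube (c \o f) = normal_tube c.
Proof.
apply/funext => r; apply/seteqP; split => x [[t [x1 x2 x3]] xr];
  split; try exact: xr.
  exists (f t); split; [exact: x1|exact: x2|apply/eqP].
  move: x3 => /eqP; rewrite derive1_reparam dotZr.
  by rewrite mulf_eq0 (negbTE (circle_diffeo_derive_neq0 df t)).
have [g [_ _ _ _ [_ gf]]] := df.
exists (g t); rewrite /= gf; split; [exact: x1|exact: x2|].
by rewrite derive1_reparam gf dotZr x3 mulr0.
Qed.

Lemma Thi_reparam : Thi (c \o f) = Thi c.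
Proof. by rewrite /Thi normal_tube_reparam. Qed.

End knot.
End reparametrisation.

(** [Rop] is computed on the chosen [repr], which differs from [g] by a circle diffeomorphism; this
    frees later arguments from that choice. *)
Lemma Rop_unparam (R : realType) (K : knot_embedding R) (g : emb_of_type K) :
  Rop (unparam g) = Len (curve_of g) / Thi (curve_of g).
Proof.
have /unparam_eq[f df ->] : unparam (repr (unparam g)) = unparam g.
  by rewrite /unparam reprK.
pose c : knot_embedding R := set_val (repr (unparam g)).
rewrite -[curve_of (repr _)]/(knot_curve c).
by rewrite (Len_reparam c df) (Thi_reparam c df).
Qed.

(** * Invariance of length, thickness and ropelength under rotations *)

(** [L] moves points and curves of the preimage into [M], where each clause of [embeds] is
    available; the intertwining relation moves values by [P], and the left inverses [K] and [Q]
    bring the conclusions back. *)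
Lemma embeds_linear_conj (R : realType) (U V : normedModType R)
    (L K : {linear U -> U}) (P Q : {linear V -> V}) (M : set U) (f : U -> V) :
  continuous L -> continuous K -> continuous P -> continuous Q ->
  cancel L K -> cancel P Q -> (forall x, f (L x) = P (f x)) ->
  embeds M f -> embeds (L @^-1` M) f.
Proof.
move=> cL cK cP cQ LK PQ fL [cf injf immf openf]; split.
(* This factorisation reduces continuity at [x] to continuity of [f] at [L x] within [M]. *)
- have fE : f = Q \o f \o L by apply/funext => x; rewrite /= fL PQ.
  apply/subspace_continuousP => x Mx.
  rewrite {2}fE [X in _ @ _ --> X]/= => W /(cQ (f (L x))) /= QW.
  move/subspace_continuousP : cf => /(_ _ Mx _ QW) /(cL x) h.
  move: h; rewrite /within /fmap /=; rewrite !nbhs_simpl /=.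
  by apply: filterS => y /= Wy /Wy; rewrite /from_subspace fL PQ.
- move=> x y; rewrite !inE => Mx My fxy; apply: (can_inj LK).
  by apply: injf; rewrite ?inE// !fL fxy.
- move=> c sc Mc c0; have := immf (L \o c) (smooth_curve_linear_comp cL sc) Mc.
  have fLc : f \o (L \o c) = P \o (f \o c) by apply/funext => t; rewrite /= fL.
  rewrite fLc (derive1_linear_comp cL (sc 0%N 0)).
  have [dfc|ndfc] := pselect (derivable (f \o c) 0 1).
    rewrite (derive1_linear_comp cP dfc) c0 linear0 => /(_ erefl) Lc0.
    by rewrite -[LHS]LK Lc0 linear0.
  (* A vanishing [derive1] does not imply differentiability. Composing with [Q] recovers [f \o c],
     so [P] cannot make a non-differentiable curve differentiable. *)
  have ndPfc : ~ derivable (P \o (f \o c)) 0 1.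
    move=> /(derivable_linear_comp cQ) dQ; apply: ndfc.
    by rewrite (_ : f \o c = Q \o (P \o (f \o c)))//; apply/funext => t /=.
  (* Both derivatives are the junk value of [lim] on a divergent filter. *)
  rewrite derive1E /derive (dvgP ndPfc).
  move: c0; rewrite derive1E /derive (dvgP ndfc) => -> /(_ erefl) Lc0.
  by rewrite -[LHS]LK Lc0 linear0.
- move=> x Mx W xW; have KW : nbhs (L x) (K @^-1` W) by apply: cK; rewrite LK.
  have [W' fW' W'W] := openf _ Mx _ KW.
  exists (P @^-1` W'); first by apply: cP; rewrite -fL.
  by move=> y [/= My]; rewrite -fL => fy; rewrite -(LK y); exact: W'W.
Qed.

Section orthogonal.
Context (R : realType).

(** The action on the normal bundle: a linear map is its own differential, so foot point and normal
    vector are multiplied by the same matrix. *)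
Definition pair_mulmxr n (A : 'M[R]_n) (x : 'rV[R]_n * 'rV[R]_n) :=
  (x.1 *m A, x.2 *m A).

Lemma pair_mulmxr_is_linear n (A : 'M[R]_n) : linear (pair_mulmxr A).
Proof.
by move=> a x y; rewrite /pair_mulmxr/= !mulmxDl -!scalemxAl.
Qed.

HB.instance Definition _ n (A : 'M[R]_n) :=
  GRing.isLinear.Build R _ _ _ (pair_mulmxr A) (pair_mulmxr_is_linear A).

Lemma pair_mulmxr_continuous n (A : 'M[R]_n) : continuous (pair_mulmxr A).
Proof.
move=> x.
have c1 : (y.1 *m A) @[y --> x] --> x.1 *m A.
  exact: (continuous_comp (@cvg_fst _ _ _ _ _)
    (@mulmxr_continuous R n n A x.1)).
have c2 : (y.2 *m A) @[y --> x] --> x.2 *m A.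
  exact: (continuous_comp (@cvg_snd _ _ _ _ _)
    (@mulmxr_continuous R n n A x.2)).
exact: (cvg_pair c1 c2).
Qed.

Lemma pair_mulmxrK n (A B : 'M[R]_n) : A *m B = 1%:M ->
  cancel (pair_mulmxr A) (pair_mulmxr B).
Proof.
by move=> AB [x y]; rewrite /pair_mulmxr/= -!mulmxA AB !mulmx1.
Qed.

(** The coefficients of [sphere_exp] depend on the normal vector only through its norm, which [A]
    preserves. *)
Lemma sphere_exp_orthogonal (A : 'M[R]_4) x : A *m A^T = 1%:M ->
  sphere_exp (pair_mulmxr A x) = sphere_exp x *m A.
Proof.
by move=> AA; rewrite /sphere_exp /= enorm_orthogonal// mulmxDl -!scalemxAl.
Qed.

Lemma embeds_sphere_exp_orthogonal (A : 'M[R]_4)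
    (M : set ('rV[R]_4 * 'rV[R]_4)) :
  A *m A^T = 1%:M -> embeds M (@sphere_exp R) ->
  embeds (pair_mulmxr A @^-1` M) (@sphere_exp R).
Proof.
move=> AA; apply: (@embeds_linear_conj R _ _ (pair_mulmxr A)
  (pair_mulmxr A^T) (mulmxr A) (mulmxr A^T)).
- exact: pair_mulmxr_continuous.
- exact: pair_mulmxr_continuous.
- exact: mulmxr_continuous.
- exact: mulmxr_continuous.
- exact: pair_mulmxrK.
- by move=> x; rewrite /= -mulmxA AA mulmx1.
- by move=> x; exact: sphere_exp_orthogonal.
Qed.

Section knot.
Context (c : knot_embedding R) (A : 'M[R]_4).
Hypothesis AA : A *m A^T = 1%:M.
Let cA : R -> 'rV[R]_4 := fun t => c t *m A.

Let derive1_cA t : derive1 cA t = derive1 c t *m A.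
Proof.
exact: (derive1_linear_comp (@mulmxr_continuous _ _ _ A)
  (@knot_smooth R c 0%N t)).
Qed.

Lemma Len_orthogonal : Len cA = Len c.
Proof.
by apply: eq_Rintegral => t _; rewrite derive1_cA enorm_orthogonal.
Qed.

Lemma normal_tube_orthogonal r :
  normal_tube c r = pair_mulmxr A @^-1` normal_tube cA r.
Proof.
apply/seteqP; split => x [[t [x1 x2 x3]] xr]; split.
- exists t; rewrite derive1_cA; split; rewrite /= ?dot_orthogonal//.
  by rewrite x1.
- by rewrite /= enorm_orthogonal.
- exists t; move: x1 x2 x3; rewrite derive1_cA /= !dot_orthogonal// => x1 x2 x3.
  split; [|exact: x2|exact: x3].
  by rewrite -[LHS]mulmx1 -AA mulmxA x1 -mulmxA AA mulmx1.
- by move: xr; rewrite /= enorm_orthogonal.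
Qed.

Lemma normal_tube_orthogonalV r :
  normal_tube cA r = pair_mulmxr A^T @^-1` normal_tube c r.
Proof.
rewrite normal_tube_orthogonal; apply/funext => x.
by rewrite /preimage/= (pair_mulmxrK (mulmx1C AA)).
Qed.

(** Both knots have the same admissible radii: each tube is the preimage of the other, under the
    action of [A] in one direction and of [A^T] in the other. *)
Lemma Thi_orthogonal : Thi cA = Thi c.
Proof.
have ATA : A^T *m A^T^T = 1%:M by rewrite trmxK mulmx1C.
rewrite /Thi; congr (sup _).
apply/seteqP; split => r [r0 er]; (split; first exact: r0).
  rewrite normal_tube_orthogonal.
  exact: (embeds_sphere_exp_orthogonal AA er).
rewrite normal_tube_orthogonalV.
exact: (embeds_sphere_exp_orthogonal ATA er).
Qed.

End knot.
End orthogonal.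

Lemma Rop_SO4_orbit (R : realType) (K : knot_embedding R)
    (J0 J : knot_space K) :
  SO4_orbit J0 J -> Rop J = Rop J0.
Proof.
move=> [A [g0 [g [[AA _] <- <- gE]]]]; rewrite !Rop_unparam.
have -> : curve_of g = (fun t => curve_of g0 t *m A) by apply/funext.
pose c : knot_embedding R := set_val g0.
rewrite -[curve_of g0]/(knot_curve c).
by rewrite (Len_orthogonal c AA) (Thi_orthogonal c AA).
Qed.

(** * Homotopy classes represented by maps into a subset *)

Section subset_representatives.
Context (R : realType) (i : nat) (X : topologicalType) (A : set X) (x0 : X).
Hypothesis Ax0 : A x0.

(** The constant homotopy does it, without comparing the proof fields of the two records. *)
Lemma hclass_ext (f g : based_map R i x0) : f =1 g -> hclass f = hclass g.
Proof.
move=> /funext fg; apply/hclass_eq.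
have [H [cH H0 H1 Hb]] := based_homotopic_refl f.
by exists H; split=> // z; rewrite H1 fg.
Qed.

(** The subspace topology is initial for [set_val], so the corestriction of [F] to [A] is
    continuous; its pushforward agrees pointwise with [F]. *)
Lemma pi_incl_factor (F : based_map R i x0) : (forall z, A (F z)) ->
  exists b : homotopy_group R i (sub_point Ax0), pi_incl b = hclass F.
Proof.
move=> AF; pose f z : set_type A := exist _ (F z) (mem_set (AF z)).
have cf : continuous f.
  by apply: continuous_comp_initial; exact: based_fun_continuous.
have fb : f (sphere_base R i) = sub_point Ax0.
  by apply: val_inj => /=; rewrite based_fun_base.
exists (hclass (BasedMap cf fb)); rewrite /pi_incl pi_mapE.
exact: hclass_ext.
Qed.

Lemma pi_incl_representative (b : homotopy_group R i (sub_point Ax0)) :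
  exists2 F : based_map R i x0, hclass F = pi_incl b & forall z, A (F z).
Proof.
exists (push (@initial_continuous (set_type A) X set_val) (repr b)) => //.
by move=> z; exact: set_valP.
Qed.

End subset_representatives.

Local Open Scope ereal_scope.

(** * Bounds on the width and the conclusion *)

Lemma Rop_le_width (R : realType) (K : knot_embedding R) (J0 : knot_space K)
    (i : nat) (a : homotopy_group R i J0) : (Rop J0)%:E <= width a.
Proof.
apply: le_ereal_inf_tmp => _ [F _ <-]; apply: ereal_sup_ubound.
exists (sphere_base R i); first exact: I.
exact: (congr1 (fun J => (Rop J)%:E) (based_fun_base F)).
Qed.

Lemma width_le (R : realType) (K : knot_embedding R) (J0 : knot_space K)
    (i : nat) (F : based_map R i J0) (l : R) :
  (forall z, (Rop (F z) <= l)%R) -> width (hclass F) <= l%:E.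
Proof.
move=> Fl; apply: (@le_trans _ _ (ereal_sup [set (Rop (F z))%:E | z in setT])).
  by apply: ereal_inf_lbound; exists F; reflexivity.
by apply: ge_ereal_sup => _ [z _ <-]; rewrite lee_fin.
Qed.

Theorem theorem5p8 (R : realType) (K : knot_embedding R) (J0 : knot_space K) :
  orbit_realised J0 ->
  (forall (i : nat) (a : homotopy_group R i J0), (1 <= i)%N ->
     [/\ width a = ((Rop J0)%:E)%E,
         excess_width a = 0%E &
         sigma_width J0 i = ((Rop J0)%:E)%E]) /\
  (forall (i : nat) (a : homotopy_group R i J0),
     exists b : homotopy_group R i (sub_point (sublevel_self J0)),
       pi_incl b = a).
Proof.
move=> orb.
have lift i (a : homotopy_group R i J0) :
    exists2 F : based_map R i J0, hclass F = a & forall z, Rop (F z) = Rop J0.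
  have [b <-] := orb i a; have [F Fb FO] := pi_incl_representative b.
  by exists F; [exact: Fb|move=> z; exact: (Rop_SO4_orbit (FO z))].
have widthE i (a : homotopy_group R i J0) : width a = (Rop J0)%:E.
  apply/le_anti/andP; split; last exact: Rop_le_width.
  have [F <- FJ0] := lift i a; apply: width_le => z; rewrite FJ0; exact: lexx.
split=> i a; last first.
  have [F <- FJ0] := lift i a; apply: pi_incl_factor => z.
  rewrite /sublevel /= FJ0; exact: lexx.
move=> _; split; first exact: widthE.
  rewrite /excess_width widthE; exact: subee.
(* All widths in degree [i] equal [Rop J0]; the given class [a] shows that the supremum is over a
   nonempty set. *)
apply/le_anti/andP; split.
  apply: ge_ereal_sup => _ [c _ <-]; rewrite widthE; exact: lexx.
by apply: ereal_sup_ubound; exists a; [exact: I|exact: widthE].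
Qed.
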